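(* (i) Let $G\le\mathrm{ASP}$ be a subgroup that is closed under $\triangleleft$. For all $\alpha,\beta,\gamma\in G$ such that $\chi_\alpha+\chi_\beta=\chi_\gamma$, one has $\alpha\star\beta\ge\gamma$ if and only if there exist $\alpha_1,\beta_1\in G$ such that $\alpha_1\le_\chi\alpha$, $\beta_1\le_\chi\beta$, and $\alpha_1\star\beta_1=\alpha_1\beta_1=\gamma$. (ii) More specifically, for all $\alpha,\beta,\gamma\in\mathrm{ASP}$, if $\alpha\star\beta\ge\gamma$, then $\alpha_1=\gamma\triangleleft\beta^{-1}$ and $\beta_1=\alpha_1^{-1}\triangleright\gamma$ satisfy $\alpha_1\star\beta_1=\alpha_1\beta_1=\gamma$, $\alpha_1\le_\chi\alpha$, and $\beta_1\le_\chi\beta$.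
   Context: A permutation means a bijection $\mathbb{Z}\to\mathbb{Z}$; products of permutations are compositions. $\mathrm{ASP}$ is the group of permutations $\alpha$ for which only finitely many $n\in\mathbb{Z}$ have exactly one of $n,\alpha(n)$ negative. For $\alpha\in\mathrm{ASP}$, $s_\alpha(a,b)=\#\{n\ge b:\ \alpha(n)<a\}$ for $a,b\in\mathbb{Z}$ (always finite; $s_\alpha$ determines $\alpha$). The shift of $\alpha$ is $\chi_\alpha=s_\alpha(0,0)-s_{\alpha^{-1}}(0,0)$. Bruhat order on $\mathrm{ASP}$: $\alpha\le\beta$ means $s_\alpha(a,b)\le s_\beta(a,b)$ for all $a,b\in\mathbb{Z}$. Write $\alpha\le_\chi\beta$ if $\alpha\le\beta$ and $\chi_\alpha=\chi_\beta$. The operations $\star,\triangleleft,\triangleright$ on $\mathrm{ASP}$ (Demazure product, left residual, right residual) are well defined and uniquely characterized by the following equations for all $a,b\in\mathbb{Z}$: $s_{\alpha\star\beta}(a,b)=\min_{\ell\in\mathbb{Z}}[s_\alpha(a,\ell)+s_\beta(\ell,b)]$, $s_{\alpha\triangleleft\beta}(a,b)=\max_{\ell\in\mathbb{Z}}[s_\alpha(a,\ell)-s_{\beta^{-1}}(b,\ell)]$, $s_{\alpha\triangleright\beta}(a,b)=\max_{\ell\in\mathbb{Z}}[s_\beta(\ell,b)-s_{\alpha^{-1}}(\ell,a)]$.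
   Formalization: Part (ii) is proved under the additional hypothesis χ_α + χ_β = χ_γ from part (i); without it (ii) fails, e.g. for α = β = id and γ(n) = n+1, where α₁ = γ has shift −1 ≠ χ_α. *)

(* Defs.v *)
From HB Require Import structures.
From mathcomp Require Export all_boot all_order all_algebra.
From mathcomp Require Export finmap boolp classical_sets functions cardinality.
From mathcomp Require Import zify.

Set Implicit Arguments.
Unset Strict Implicit.
Unset Printing Implicit Defensive.

Import Order.TTheory GRing.Theory Num.Theory.

Local Open Scope classical_set_scope.
Local Open Scope ring_scope.

(* The inverse is stored with the function; it is determined by it, so equality
   in [ASP] is pointwise equality of functions (lemma [ASP_eqP]). *)
Record ASP := MkASP {
  asp_fun :> int -> int;
  asp_inv : int -> int;
  asp_funK : cancel asp_fun asp_inv;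
  asp_invK : cancel asp_inv asp_fun;
  asp_finite : finite_set [set n : int | (n < 0) (+) (asp_fun n < 0)]
}.

Lemma ASP_eqP (alpha beta : ASP) : alpha = beta <-> alpha =1 beta.
Proof.
split=> [-> //|].
case: alpha beta => [f f' fK f'K ff] [g g' gK g'K gf] /= /funext fg; subst g.
have fg' : f' = g' by apply/funext => n; rewrite -{1}(g'K n) fK.
by subst g'; congr MkASP; exact: Prop_irrelevance.
Qed.

HB.instance Definition _ := gen_eqMixin ASP.
HB.instance Definition _ := gen_choiceMixin ASP.

Lemma asp1_finite : finite_set [set n : int | (n < 0) (+) (idfun n < 0)].
Proof.
suff -> : [set n : int | (n < 0) (+) (idfun n < 0)] = set0 by [].
by apply/seteqP; split=> n //=; rewrite addbb.
Qed.

Definition asp1 : ASP :=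
  @MkASP idfun idfun (fun=> erefl) (fun=> erefl) asp1_finite.

Lemma aspV_finite (alpha : ASP) :
  finite_set [set n : int | (n < 0) (+) (asp_inv alpha n < 0)].
Proof.
apply: sub_finite_set (finite_image alpha (asp_finite alpha)) => n /= nP.
by exists (asp_inv alpha n); [rewrite /= asp_invK addbC | exact: asp_invK].
Qed.

Definition aspV (alpha : ASP) : ASP :=
  MkASP (@asp_invK alpha) (@asp_funK alpha) (aspV_finite alpha).

Lemma aspM_finite (alpha beta : ASP) :
  finite_set [set n : int | (n < 0) (+) ((alpha \o beta) n < 0)].
Proof.
have := finite_image (asp_inv beta) (asp_finite alpha).
move=> /(conj (asp_finite beta)); rewrite -finite_setU; apply: sub_finite_set => n /= nP.
case: (boolP ((n < 0) (+) (beta n < 0))) => nb; [by left | right].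
exists (beta n); last by rewrite asp_funK.
by move: nP nb => /=; case: (n < 0); case: (beta n < 0); case: (_ < 0).
Qed.

(* (alpha beta)(n) = alpha(beta(n)) *)
Definition aspM (alpha beta : ASP) : ASP :=
  MkASP (can_comp (@asp_funK alpha) (@asp_funK beta))
        (can_comp (@asp_invK beta) (@asp_invK alpha))
        (aspM_finite alpha beta).

Lemma aspMA : associative aspM.
Proof. by move=> x y z; apply/ASP_eqP. Qed.

Lemma asp1M : left_id asp1 aspM.
Proof. by move=> x; apply/ASP_eqP. Qed.

Lemma aspM1 : right_id asp1 aspM.
Proof. by move=> x; apply/ASP_eqP. Qed.

Lemma aspVM : left_inverse asp1 aspV aspM.
Proof. by move=> x; apply/ASP_eqP => n /=; rewrite asp_funK. Qed.

Lemma aspMV : right_inverse asp1 aspV aspM.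
Proof. by move=> x; apply/ASP_eqP => n /=; rewrite asp_invK. Qed.

HB.instance Definition _ := isGroup.Build ASP aspMA asp1M aspM1 aspVM aspMV.

Lemma asp_slice_finite (alpha : ASP) (a b : int) :
  finite_set [set n : int | b <= n /\ alpha n < a].
Proof.
have fin_itv (x : int) : finite_set [set n : int | `|n| <= x].
  apply: sub_finite_set (finite_image (fun k : nat => k%:Z - `|x|)
    (finite_II (2 * absz x).+1)) => n /= nx.
  by exists (absz (n + `|x|)) => /=; lia.
have := finite_image (asp_inv alpha) (fin_itv `|a|).
move=> /(conj (fin_itv `|b|)); rewrite -finite_setU.
move=> /(conj (asp_finite alpha)); rewrite -finite_setU.
apply: sub_finite_set => n /= [bn na].
have [n0|n0] := ltP n 0; first by right; left; lia.
have [an0|an0] := ltP (alpha n) 0; first by left.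
by right; right; exists (alpha n); rewrite ?asp_funK //=; lia.
Qed.

(* [fset_set] sends an infinite set to the empty one; here the set is always
   finite, by [asp_slice_finite]. *)
Definition asp_s (alpha : ASP) (a b : int) : nat :=
  #|` fset_set [set n : int | b <= n /\ alpha n < a] |.

Definition shift (alpha : ASP) : int :=
  (asp_s alpha 0 0)%:Z - (asp_s (alpha^-1)%g 0 0)%:Z.

Definition bruhat_le (alpha beta : ASP) : Prop :=
  forall a b : int, (asp_s alpha a b <= asp_s beta a b)%N.

Definition bruhat_chi_le (alpha beta : ASP) : Prop :=
  bruhat_le alpha beta /\ shift alpha = shift beta.

(* The extremum over all l has to be attained. *)
Definition is_min_over (F : int -> int) (m : int) : Prop :=
  range F m /\ lbound (range F) m.

Definition is_max_over (F : int -> int) (m : int) : Prop :=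
  range F m /\ ubound (range F) m.

(* Each of the three operations returns the unique element of [ASP] satisfying
   its defining equations. Such an element always exists, so that the default
   value 1 of [xget] plays no role. *)
Definition demazure (alpha beta : ASP) : ASP :=
  xget 1%g [set delta : ASP | forall a b : int,
    is_min_over (fun l => (asp_s alpha a l)%:Z + (asp_s beta l b)%:Z)
                (asp_s delta a b)].

Definition lresidual (alpha beta : ASP) : ASP :=
  xget 1%g [set delta : ASP | forall a b : int,
    is_max_over (fun l => (asp_s alpha a l)%:Z - (asp_s (beta^-1)%g b l)%:Z)
                (asp_s delta a b)].

Definition rresidual (alpha beta : ASP) : ASP :=
  xget 1%g [set delta : ASP | forall a b : int,
    is_max_over (fun l => (asp_s beta l b)%:Z - (asp_s (alpha^-1)%g l a)%:Z)
                (asp_s delta a b)].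

(* Main.v *)
Require Import Defs.
From mathcomp Require Import zify.

(** Everything is read off the counting functions [asp_s alpha], and the
    inequality [gamma <= demazure alpha beta] says
      s_gamma(a,b) <= s_alpha(a,l) + s_beta(l,b)   for all a, l, b.
    Moving the last term to the left, this is exactly [lresidual gamma
    beta^-1 <= alpha]: the residual [alpha1] is the least left factor
    whose Demazure product with [beta] dominates [gamma] ([lresidual_le]).
    Shifts add under the residual, so [alpha1] and [alpha] have the same
    shift.

    The heart of the matter is that [alpha1], defined by a maximum of
    counting functions, is related to [gamma] as a permutation: two values
    that appear in the wrong order in [alpha1] also do so in [gamma]
    ([lresidual_inversion]); that is, [alpha1] precedes [gamma] in the
    weak order.  Hence the ordinary factorization gamma = alpha1
    (alpha1^-1 gamma) is reduced: no pair of integers is inverted both by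
    [alpha1] and by the inverse of the cofactor.

    For a reduced product [alpha * beta] a suitable cut [l] makes
      s_{alpha beta}(a,b) = s_alpha(a,l) + s_beta(l,b),
    and conversely, for given [l] and [b], the equality holds for a
    suitable row [a] ([no_common_inversion_min],
    [no_common_inversion_max]).  The first fact says that the Demazure
    product is the ordinary one, the second that [beta] is the right
    residual [rresidual alpha^-1 (alpha * beta)].  Applied to [alpha1] and
    its cofactor this identifies [beta1] with the cofactor alpha1^-1
    gamma, and the maximum defining [alpha1] bounds it by [beta].  A
    subgroup containing [alpha1] and [gamma] contains the cofactor, which
    gives the statement relative to a subgroup; its converse is the
    monotonicity of the Demazure product ([demazure_mono]).

    That the Demazure product and the left residual satisfy their defining
    equations at all rests on a characterization of the functions [asp_s
    alpha] by an exchange inequality and their behaviour at infinity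
    ([asp_of_profile]). *)

Set Implicit Arguments.
Unset Strict Implicit.
Unset Printing Implicit Defensive.

Import Order.TTheory GRing.Theory Num.Theory.

Local Open Scope classical_set_scope.
Local Open Scope ring_scope.

(** * Induction, extrema and cuts over the integers *)

Lemma int_upward (P : int -> Prop) (m : int) :
  P m -> (forall n, m <= n -> P n -> P (n + 1)) -> forall n, m <= n -> P n.
Proof.
move=> Pm PS n mn; have -> : n = m + (absz (n - m))%:Z by lia.
elim: (absz _) => [|k IHk]; first by rewrite addr0.
by rewrite -addn1 PoszD addrA; apply: PS => //; lia.
Qed.

Lemma int_downward (P : int -> Prop) (m : int) :
  P m -> (forall n, n < m -> P (n + 1) -> P n) -> forall n, n <= m -> P n.
Proof.
move=> Pm PS n nm; have -> : n = - (- n) by lia.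
apply: (@int_upward (fun k => P (- k)) (- m)); rewrite ?opprK //; last by lia.
by move=> k mk Pk; apply: PS; [lia | rewrite opprD subrK].
Qed.

Lemma int_min (P : int -> Prop) (m n : int) :
  P n -> (forall x, P x -> m <= x) -> exists2 x, P x & forall y, P y -> x <= y.
Proof.
move=> Pn Pm; move: {2}(absz _) (leqnn (absz (n - m))) => k.
elim: k n Pn => [|k IHk] n Pn nk.
  by exists n => // y Py; have := Pm _ Py; have := Pm _ Pn; lia.
have [[y Py yn]|noy] := pselect (exists2 y, P y & y < n).
  by apply: (IHk y) => //; have := Pm _ Py; have := Pm _ Pn; lia.
exists n => // y Py; rewrite leNgt; apply/negP => yn; apply: noy; by exists y.
Qed.

(** The cut is the minimum of [B], or the bound of [A] if [B] is empty. *)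
Lemma int_separation (A B : set int) (u v : int) :
  (forall x y, A x -> B y -> x < y) ->
  (forall x, A x -> x < u) -> (forall y, B y -> v <= y) ->
  exists l, (forall x, A x -> x < l) /\ (forall y, B y -> l <= y).
Proof.
move=> AB Au Bv; have [[y By]|noB] := pselect (exists y, B y).
  have [l Bl lB] := int_min By Bv.
  by exists l; split=> [x Ax|//]; exact: AB.
by exists u; split=> // y By; case: noB; exists y.
Qed.

(** A monotone integer sequence going from 0 to 1 is an indicator; this is
    how the value of a permutation at a point is recovered from counts. *)
Lemma int_threshold (d : int -> int) (u v : int) :
  (forall n, d n <= d (n + 1)) ->
  (forall n, n <= u -> d n = 0) -> (forall n, v <= n -> d n = 1) ->
  exists p : int, forall n, d n = (p < n)%R%:Z.
Proof.
move=> dS du dv.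
have dmono m n : m <= n -> d m <= d n.
  by move: n; apply: int_upward => // n _ mn; apply: le_trans (dS n).
have d0 n : 0 <= d n.
  have := @dmono (Order.min n u) n; rewrite (du (Order.min n u)); lia.
have d1 n : d n <= 1.
  have := @dmono n (Order.max n v); rewrite (dv (Order.max n v)); lia.
have [x dx xP] : exists2 x, 0 < d x & forall y, 0 < d y -> x <= y.
  apply: (@int_min _ u v); first by rewrite dv.
  by move=> x; case: (leP x u) => [/du->//|/ltW].
exists (x - 1) => n; have := d0 n; have := d1 n.
case: (ltP (x - 1) n) => xn; first by have := @dmono x n; lia.
by have := xP n; lia.
Qed.

Lemma min_over_exists (F : int -> int) (m : int) :
  (forall l, m <= F l) -> exists x, is_min_over F x.
Proof.
move=> Fm; have [|x Fx xF] := @int_min (range F) m (F 0) (imageT F 0).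
  by move=> _ [l _ <-].
by exists x; split=> // y Fy; exact: xF.
Qed.

Lemma max_over_exists (F : int -> int) (m : int) :
  (forall l, F l <= m) -> exists x, is_max_over F x.
Proof.
move=> Fm; have [|x] := @min_over_exists (fun l => - F l) (- m).
  by move=> l; rewrite lerN2.
case=> -[l _ <-] lP; exists (F l); split; first by exists l.
by move=> _ [k _ <-]; rewrite -lerN2; apply: lP; exists k.
Qed.

(** * Cardinals of finite sets *)

Lemma finite_int_bounded (A : set int) :
  finite_set A -> exists M, forall n, A n -> `|n| <= M.
Proof.
move=> /finite_fsetP[X ->].
have [M MP] : exists M, forall n, n \in enum_fset X -> `|n| <= M.
  elim: (enum_fset X) => [|x s [M IH]]; first by exists 0.
  exists (Order.max `|x| M) => n; rewrite inE => /orP[/eqP ->|/IH]; lia.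
by exists M.
Qed.

Lemma card_fset_setU1 (T : choiceType) (x : T) (A : set T) :
  finite_set A -> ~ A x ->
  #|` fset_set (x |` A)| = (#|` fset_set A|).+1.
Proof.
move=> fA nAx; rewrite fset_setU1 // cardfsU1 in_fset_set //.
by rewrite (_ : (x \in A) = false) //; apply/negbTE/negP; rewrite inE.
Qed.

Lemma leq_card_fset_set (T : choiceType) (A B : set T) :
  finite_set B -> A `<=` B -> (#|` fset_set A| <= #|` fset_set B|)%N.
Proof.
move=> fB AB; apply: fsubset_leq_card; rewrite -fset_set_sub //.
exact: sub_finite_set fB.
Qed.

Lemma leq_card_fset_setU (T : choiceType) (A B : set T) :
  finite_set A -> finite_set B ->
  (#|` fset_set (A `|` B)| <= #|` fset_set A| + #|` fset_set B|)%N.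
Proof. by move=> fA fB; rewrite fset_setU // cardfsU leq_subr. Qed.

Lemma card_fset_setU (T : choiceType) (A B : set T) :
  finite_set A -> finite_set B -> A `&` B = set0 ->
  #|` fset_set (A `|` B)| = (#|` fset_set A| + #|` fset_set B|)%N.
Proof.
move=> fA fB AB; rewrite fset_setU // cardfsU -fset_setI // AB fset_set0.
by rewrite cardfs0 subn0.
Qed.

Lemma card_fset_set_image (T U : choiceType) (f : T -> U) (A : set T) :
  injective f -> finite_set A ->
  #|` fset_set (f @` A)| = #|` fset_set A|.
Proof. by move=> fI fA; rewrite fset_set_image // card_imfset. Qed.

(** * The counting function of a permutation *)

Lemma aspK (alpha : ASP) : cancel alpha (alpha^-1)%g.
Proof. exact: asp_funK. Qed.

Lemma aspVK (alpha : ASP) : cancel (alpha^-1)%g alpha.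
Proof. exact: asp_invK. Qed.

Lemma asp_s_stepr (alpha : ASP) (a b : int) :
  (asp_s alpha a b)%:Z = (asp_s alpha a (b + 1))%:Z + (alpha b < a)%R%:Z.
Proof.
case: (ltP (alpha b) a) => ab; last first.
  rewrite addr0; congr (_ #|` fset_set _ |); apply/seteqP; split=> n /= [bn na].
    split=> //; suff : b != n by lia.
    by apply/eqP => bE; move: na; rewrite -bE; lia.
  by split=> //; lia.
rewrite -PoszD addn1 -(card_fset_setU1 (x := b)); last 2 first.
- exact: asp_slice_finite.
- by move=> /= []; lia.
congr (_ #|` fset_set _ |); apply/seteqP; split=> n /=.
  move=> [bn na]; have [->|bn'] := eqVneq n b; [by left|right; split=> //; lia].
by case=> [->|[bn na]]; split=> //; lia.
Qed.

Lemma asp_s_stepl (alpha : ASP) (a b : int) :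
  (asp_s alpha (a + 1) b)%:Z
  = (asp_s alpha a b)%:Z + (b <= (alpha^-1)%g a)%R%:Z.
Proof.
case: (leP b ((alpha^-1)%g a)) => ab; last first.
  rewrite addr0; congr (_ #|` fset_set _ |); apply/seteqP; split=> n /= [bn na].
    split=> //; suff : alpha n != a by lia.
    by apply/eqP => nE; move: ab; rewrite -nE aspK; lia.
  by split=> //; lia.
rewrite -PoszD addn1 -(card_fset_setU1 (x := (alpha^-1)%g a)); last 2 first.
- exact: asp_slice_finite.
- by move=> /= []; rewrite aspVK; lia.
congr (_ #|` fset_set _ |); apply/seteqP; split=> n /=.
  move=> [bn na]; have [nE|nE] := eqVneq (alpha n) a.
    by left; rewrite -nE; exact/esym/aspK.
  by right; split=> //; lia.
by case=> [->|[bn na]]; rewrite ?aspVK; split=> //; lia.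
Qed.

(** The difference of the two counts drops by one when [b] increases, and
    grows by one when [a] does: when [b] is passed, either [b] leaves the
    first count or [alpha b] enters the second.  Its value at the origin
    is the shift. *)
Lemma asp_s_dual (alpha : ASP) (a b : int) :
  (asp_s alpha a b)%:Z = (asp_s (alpha^-1)%g b a)%:Z + shift alpha + a - b.
Proof.
pose D (x y : int) : int :=
  (asp_s alpha x y)%:Z - (asp_s (alpha^-1)%g y x)%:Z - x + y.
have Da (x y : int) : D (x + 1) y = D x y.
  rewrite /D; have := asp_s_stepl alpha x y.
  by have := asp_s_stepr (alpha^-1)%g y x; lia.
have Db (x y : int) : D x (y + 1) = D x y.
  rewrite /D; have := asp_s_stepr alpha x y.
  have := asp_s_stepl (alpha^-1)%g y x; rewrite invgK; lia.
have const (f : int -> int) : (forall n, f (n + 1) = f n) ->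
    forall n, f n = f 0.
  move=> fS n; case: (leP 0 n) => [|/ltW]; move: n.
    by apply: int_upward => // n _; rewrite fS.
  by apply: int_downward => // n _; rewrite fS.
have : D a b = D 0 0.
  by rewrite (const (D a) (Db a)) (const (D^~ 0) (Da^~ 0)).
rewrite /D /shift; lia.
Qed.

Lemma shiftV (alpha : ASP) : shift (alpha^-1)%g = - shift alpha.
Proof. by rewrite /shift invgK opprB. Qed.

Lemma asp_s_ge (alpha : ASP) (a b : int) :
  shift alpha + a - b <= (asp_s alpha a b)%:Z.
Proof. by have := asp_s_dual alpha a b; lia. Qed.

Lemma asp_s_decr (alpha : ASP) (a b b' : int) : b <= b' ->
  (asp_s alpha a b')%:Z <= (asp_s alpha a b)%:Z
    <= (asp_s alpha a b')%:Z + (b' - b).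
Proof.
move: b'; apply: int_upward; first by lia.
move=> n _; have := asp_s_stepr alpha a n; case: (_ < _); lia.
Qed.

Lemma asp_s_incr (alpha : ASP) (a a' b : int) : a <= a' ->
  (asp_s alpha a b)%:Z <= (asp_s alpha a' b)%:Z
    <= (asp_s alpha a b)%:Z + (a' - a).
Proof.
move=> /(asp_s_decr (alpha^-1)%g b).
have := asp_s_dual alpha a b; have := asp_s_dual alpha a' b; lia.
Qed.

(** The difference of the two sides counts the n in [b, b') with a <=
    alpha n < a'. *)
Lemma asp_s_supermod (alpha : ASP) (a a' b b' : int) : a <= a' -> b <= b' ->
  (asp_s alpha a b + asp_s alpha a' b'
   <= asp_s alpha a' b + asp_s alpha a b')%N.
Proof.
move=> aa'; move: b'; apply: int_upward; first by lia.
move=> n _; have := asp_s_stepr alpha a n; have := asp_s_stepr alpha a' n.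
lia.
Qed.

Lemma asp_s_eq0 (alpha : ASP) (a b : int) :
  asp_s alpha a b = 0%N <-> forall n, b <= n -> a <= alpha n.
Proof.
have fin := asp_slice_finite alpha a b; split=> [/cardfs0_eq s0 n bn|geq].
  rewrite leNgt; apply/negP => na.
  have := in_fset_set fin n; rewrite s0 inE => /esym/negP; apply.
  by rewrite inE.
apply/eqP; rewrite cardfs_eq0 -fset_set0; apply/eqP; congr fset_set.
by apply/seteqP; split=> n //= -[/geq]; lia.
Qed.

Lemma asp_s_zeror (alpha : ASP) (a : int) :
  exists B, forall b, B <= b -> asp_s alpha a b = 0%N.
Proof.
have [M MP] := finite_int_bounded (asp_slice_finite alpha a 0).
exists (Order.max 0 (M + 1)) => b Bb; apply/asp_s_eq0 => n bn.
rewrite leNgt; apply/negP => na; have /MP : 0 <= n /\ alpha n < a by lia.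
by lia.
Qed.

Lemma asp_s_zerol (alpha : ASP) (b : int) :
  exists A, forall a, a <= A -> asp_s alpha a b = 0%N.
Proof.
have [M MP] := finite_int_bounded
  (finite_image alpha (asp_slice_finite alpha 0 b)).
exists (Order.min 0 (- M)) => a Aa; apply/asp_s_eq0 => n bn.
have [?|n0] := leP 0 (alpha n); first by lia.
have /MP : (alpha @` [set n | b <= n /\ alpha n < 0]) (alpha n) by exists n.
by lia.
Qed.

(** Column [n] exceeds column [n + 1] exactly in the rows above [alpha n]. *)
Lemma asp_s_inj (alpha beta : ASP) :
  (forall a b, asp_s alpha a b = asp_s beta a b) -> alpha = beta.
Proof.
move=> sE; apply/ASP_eqP => n.
have E a : (alpha n < a) = (beta n < a).
  have := asp_s_stepr alpha a n; have := asp_s_stepr beta a n.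
  by rewrite !sE; lia.
have := E (alpha n + 1); have := E (beta n + 1); lia.
Qed.

(** An n counted on the left has [beta n] either below the cut [l], or
    above it and then sent below [a] by [alpha]. *)
Lemma asp_sM_le (alpha beta : ASP) (a l b : int) :
  (asp_s (alpha * beta)%g a b <= asp_s alpha a l + asp_s beta l b)%N.
Proof.
rewrite /asp_s -(@card_fset_set_image _ _ (beta^-1)%g
  [set n | l <= n /\ alpha n < a]); last 2 first.
- exact: can_inj (aspVK beta).
- exact: asp_slice_finite.
rewrite addnC; apply: leq_trans (leq_card_fset_setU _ _); last 2 first.
- exact: asp_slice_finite.
- by apply: finite_image; exact: asp_slice_finite.
apply: leq_card_fset_set.
  rewrite finite_setU; split; first exact: asp_slice_finite.
  by apply: finite_image; exact: asp_slice_finite.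
move=> n /= [bn na]; have [nl|nl] := ltP (beta n) l; first by left.
by right; exists (beta n); [rewrite /= | exact: aspK].
Qed.

(** The two kinds of n behind [asp_sM_le] are disjoint, and the hypotheses
    say that each n of either kind is counted by the product. *)
Lemma asp_sM_eq (alpha beta : ASP) (a l b : int) :
  (forall n, b <= n -> beta n < l -> alpha (beta n) < a) ->
  (forall n, n < b -> l <= beta n -> a <= alpha (beta n)) ->
  asp_s (alpha * beta)%g a b = (asp_s alpha a l + asp_s beta l b)%N.
Proof.
move=> H1 H2; apply/eqP; rewrite eqn_leq asp_sM_le /=.
rewrite /asp_s -(@card_fset_set_image _ _ (beta^-1)%g
  [set n | l <= n /\ alpha n < a]); last 2 first.
- exact: can_inj (aspVK beta).
- exact: asp_slice_finite.
rewrite addnC -card_fset_setU; last 3 first.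
- exact: asp_slice_finite.
- exact: (finite_image _ (asp_slice_finite alpha a l)).
- apply/seteqP; split=> n //= -[[bn nl] [m [lm _] mE]].
  by move: nl; rewrite -mE aspVK; lia.
apply: leq_card_fset_set; first exact: (asp_slice_finite (alpha * beta)%g).
move=> n /= [[bn nl]|[m [lm ma] <-]]; first by split=> //; exact: H1.
rewrite aspVK; split=> //; rewrite leNgt; apply/negP => mb.
by have := H2 _ mb; rewrite aspVK => /(_ lm); lia.
Qed.

(** With [l] and then [b] far to the left, both terms on the right of
    [asp_sM_le] reduce to their linear parts, and the left side is at
    least its own. *)
Lemma shiftM_le (alpha beta : ASP) :
  shift (alpha * beta)%g <= shift alpha + shift beta.
Proof.
have [l lP] := asp_s_zerol (alpha^-1)%g 0.
have [b bP] := asp_s_zerol (beta^-1)%g l.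
have := asp_s_ge (alpha * beta)%g 0 b; have := asp_sM_le alpha beta 0 l b.
have := asp_s_dual alpha 0 l; have := asp_s_dual beta l b.
rewrite lP // bP //; lia.
Qed.

Lemma shiftM (alpha beta : ASP) :
  shift (alpha * beta)%g = shift alpha + shift beta.
Proof.
have := shiftM_le (beta^-1)%g (alpha^-1)%g; have := shiftM_le alpha beta.
have -> : (beta^-1 * alpha^-1)%g = ((alpha * beta)^-1)%g by rewrite invgM.
rewrite !shiftV; lia.
Qed.

(** * Which functions are counting functions *)

(** The first clause makes the mixed second difference of [f] nonnegative;
    for [asp_s alpha] it is the permutation matrix of [alpha]. *)
Definition asp_profile (c : int) (f : int -> int -> int) : Prop :=
  [/\ forall a b, f a b + f (a + 1) (b + 1) <= f (a + 1) b + f a (b + 1),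
      forall a, exists B, forall b, B <= b -> f a b = 0,
      forall a, exists B, forall b, b <= B -> f a b = c + a - b,
      forall b, exists A, forall a, a <= A -> f a b = 0 &
      forall b, exists A, forall a, A <= a -> f a b = c + a - b].

(** The difference of [f] between columns [b] and [b + 1] is monotone in
    the row and goes from 0 to 1, so that it is the indicator of the rows
    above some [phi b]; rows give [psi] likewise.  Both describe the
    positions of the entries 1 of the mixed difference, so they are
    mutually inverse. *)
Lemma asp_of_profile (c : int) (f : int -> int -> int) :
  asp_profile c f ->
  exists delta : ASP,
    (forall a b, (asp_s delta a b)%:Z = f a b) /\ shift delta = c.
Proof.
case=> fS f0r fcr f0l fcl.
have /choice[phi phiP] : forall b : int, exists p : int,
    forall a, f a b - f a (b + 1) = (p < a)%R%:Z.
  move=> b; have [u uP] := f0l b; have [u' u'P] := f0l (b + 1).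
  have [v vP] := fcl b; have [v' v'P] := fcl (b + 1).
  apply: (@int_threshold _ (Order.min u u') (Order.max v v')) => n.
  - by have := fS n b; lia.
  - by move=> nu; rewrite uP ?u'P; lia.
  - by move=> nv; rewrite vP ?v'P; lia.
have /choice[psi psiP] : forall a : int, exists p : int,
    forall b, f (a + 1) b - f a b = (b <= p)%R%:Z.
  move=> a; have [u uP] := f0r a; have [u' u'P] := f0r (a + 1).
  have [v vP] := fcr a; have [v' v'P] := fcr (a + 1).
  have [n|n|n|p pP] := @int_threshold (fun b => 1 - (f (a + 1) b - f a b))
    (Order.min v v') (Order.max u u').
  - by have := fS a n; lia.
  - by move=> nv; rewrite vP ?v'P; lia.
  - by move=> nu; rewrite uP ?u'P; lia.
  by exists p => b; have := pP b; lia.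
have phipsi a b : (phi b == a) = (psi a == b).
  have := phiP b a; have := phiP b (a + 1).
  have := psiP a b; have := psiP a (b + 1); lia.
have phiK : cancel phi psi by move=> b; apply/eqP; rewrite -phipsi.
have psiK : cancel psi phi by move=> a; apply/eqP; rewrite phipsi.
have fin : finite_set [set n : int | (n < 0) (+) (phi n < 0)].
  have [u uP] := f0r 0; have [v vP] := fcr 0.
  have fin_itv (x : nat) : finite_set [set n : int | `|n| <= x%:Z].
    apply: sub_finite_set (finite_image (fun k : nat => k%:Z - x%:Z)
      (finite_II (2 * x).+1)) => n /= nx.
    by exists (absz (n + x%:Z)) => /=; lia.
  apply: sub_finite_set (fin_itv (absz u + absz v + 1)%N) => n /=.
  have := phiP n 0; case: (ltP n 0) => n0 /= phin phn.
    have [nv|nv] := leP (n + 1) v; last by lia.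
    by move: phin phn; rewrite !vP; lia.
  have [nu|nu] := leP u n; last by lia.
  by move: phin phn; rewrite !uP; lia.
pose delta := MkASP phiK psiK fin.
have sE a b : (asp_s delta a b)%:Z = f a b.
  have [u uP] := f0r a; have [u' u'P] := asp_s_zeror delta a.
  have E n : Order.max u u' <= n -> (asp_s delta a n)%:Z = f a n.
    by move=> nu; rewrite uP ?u'P; lia.
  have [ub|bu] := leP (Order.max u u') b; first exact: E.
  move: (ltW bu); move: b {bu}; apply: int_downward => [|n _ IH].
    exact: E.
  by have := asp_s_stepr delta a n; have := phiP n a; rewrite /= IH; lia.
exists delta; split=> //.
have [u uP] := fcl 0; have [v vP] := asp_s_zeror (delta^-1)%g 0.
have := asp_s_dual delta (Order.max u v) 0; rewrite sE uP ?vP; lia.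
Qed.

Lemma asp_s_profile (alpha : ASP) :
  asp_profile (shift alpha) (fun a b => (asp_s alpha a b)%:Z).
Proof.
split=> [a b|a|a|b|b].
- by have := @asp_s_supermod alpha a (a + 1) b (b + 1); lia.
- by have [B BP] := asp_s_zeror alpha a; exists B => b /BP ->.
- have [B BP] := asp_s_zerol (alpha^-1)%g a; exists B => b /BP E.
  by rewrite asp_s_dual E; lia.
- by have [A AP] := asp_s_zerol alpha b; exists A => a /AP ->.
- have [A AP] := asp_s_zeror (alpha^-1)%g b; exists A => a /AP E.
  by rewrite asp_s_dual E; lia.
Qed.

(** * Existence of the Demazure product and of the left residual *)

Definition demazure_law (alpha beta delta : ASP) : Prop := forall a b : int,
  is_min_over (fun l => (asp_s alpha a l)%:Z + (asp_s beta l b)%:Z)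
              (asp_s delta a b).

Definition lresidual_law (alpha beta delta : ASP) : Prop := forall a b : int,
  is_max_over (fun l => (asp_s alpha a l)%:Z - (asp_s (beta^-1)%g b l)%:Z)
              (asp_s delta a b).

Definition rresidual_law (alpha beta delta : ASP) : Prop := forall a b : int,
  is_max_over (fun l => (asp_s beta l b)%:Z - (asp_s (alpha^-1)%g l a)%:Z)
              (asp_s delta a b).

Lemma is_min_over_uniq (F : int -> int) (x y : int) :
  is_min_over F x -> is_min_over F y -> x = y.
Proof.
by move=> [Fx xF] [Fy yF]; apply/eqP; rewrite eq_le; apply/andP; split;
  [exact: xF | exact: yF].
Qed.

Lemma is_max_over_uniq (F : int -> int) (x y : int) :
  is_max_over F x -> is_max_over F y -> x = y.
Proof.
by move=> [Fx xF] [Fy yF]; apply/eqP; rewrite eq_le; apply/andP; split;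
  [exact: yF | exact: xF].
Qed.

Lemma demazure_uniq (alpha beta delta : ASP) :
  demazure_law alpha beta delta -> demazure alpha beta = delta.
Proof.
move=> deltaP.
have P : demazure_law alpha beta (demazure alpha beta).
  exact: (xgetPex _ (ex_intro (demazure_law alpha beta) delta deltaP)).
apply: asp_s_inj => a b; have := is_min_over_uniq (P a b) (deltaP a b).
by case.
Qed.

Lemma lresidual_uniq (alpha beta delta : ASP) :
  lresidual_law alpha beta delta -> lresidual alpha beta = delta.
Proof.
move=> deltaP.
have P : lresidual_law alpha beta (lresidual alpha beta).
  exact: (xgetPex _ (ex_intro (lresidual_law alpha beta) delta deltaP)).
apply: asp_s_inj => a b; have := is_max_over_uniq (P a b) (deltaP a b).
by case.
Qed.

Lemma rresidual_uniq (alpha beta delta : ASP) :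
  rresidual_law alpha beta delta -> rresidual alpha beta = delta.
Proof.
move=> deltaP.
have P : rresidual_law alpha beta (rresidual alpha beta).
  exact: (xgetPex _ (ex_intro (rresidual_law alpha beta) delta deltaP)).
apply: asp_s_inj => a b; have := is_max_over_uniq (P a b) (deltaP a b).
by case.
Qed.

Lemma choice2 (P : int -> int -> int -> Prop) :
  (forall a b, exists x, P a b x) -> exists f, forall a b, P a b (f a b).
Proof.
move=> ex; have /choice[f fP] : forall a, exists g : int -> int,
    forall b, P a b (g b).
  by move=> a; have [g gP] := choice (ex a); exists g.
by exists f.
Qed.

Lemma min_over_attained (F : int -> int) (m : int) :
  is_min_over F m -> (exists l, F l = m) /\ forall l, m <= F l.
Proof.
by case=> -[l _ Fl] mP; split=> [|k]; [exists l | apply: mP; exists k].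
Qed.

Lemma max_over_attained (F : int -> int) (m : int) :
  is_max_over F m -> (exists l, F l = m) /\ forall l, F l <= m.
Proof.
by case=> -[l _ Fl] mP; split=> [|k]; [exists l | apply: mP; exists k].
Qed.

(** The exchange inequality is obtained from optimal cuts [l] and [m] for
    the entries (a + 1, b) and (a, b + 1): [l] serves the new entry in
    column [b] and [m] the one in column [b + 1] if l <= m, the other way
    round otherwise.  The behaviour at infinity comes from one cut placed
    where both summands have their limiting form, against the lower bounds
    0 and c + a - b. *)
Lemma demazure_profile (alpha beta : ASP) (f : int -> int -> int) :
  (forall a b, is_min_over
     (fun l => (asp_s alpha a l)%:Z + (asp_s beta l b)%:Z) (f a b)) ->
  asp_profile (shift alpha + shift beta) f.
Proof.
move=> fP.
have attained a b : exists l,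
    (asp_s alpha a l)%:Z + (asp_s beta l b)%:Z = f a b.
  by have [] := min_over_attained (fP a b).
have f_le a b l : f a b <= (asp_s alpha a l)%:Z + (asp_s beta l b)%:Z.
  by have [_] := min_over_attained (fP a b).
have ge0 a b : 0 <= f a b by have [l <-] := attained a b; lia.
have gec a b : shift alpha + shift beta + a - b <= f a b.
  have [l <-] := attained a b.
  by have := asp_s_ge alpha a l; have := asp_s_ge beta l b; lia.
split=> [a b|a|a|b|b].
- have [l lP] := attained (a + 1) b; have [m mP] := attained a (b + 1).
  have [lm|/ltW ml] := leP l m.
    have := @asp_s_supermod alpha a (a + 1) l m; have := f_le a b l.
    by have := f_le (a + 1) (b + 1) m; lia.
  have := @asp_s_supermod beta m l b (b + 1); have := f_le a b m.
  by have := f_le (a + 1) (b + 1) l; lia.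
- have [_ z _ _ _] := asp_s_profile alpha; have [l lP] := z a.
  have [_ z' _ _ _] := asp_s_profile beta; have [B BP] := z' l.
  by exists B => b /BP sb; have := f_le a b l; have := ge0 a b; rewrite lP; lia.
- have [_ _ z _ _] := asp_s_profile alpha; have [l lP] := z a.
  have [_ _ z' _ _] := asp_s_profile beta; have [B BP] := z' l.
  by exists B => b /BP sb; have := f_le a b l; have := gec a b; rewrite lP; lia.
- have [_ _ _ z _] := asp_s_profile beta; have [l lP] := z b.
  have [_ _ _ z' _] := asp_s_profile alpha; have [A AP] := z' l.
  by exists A => a /AP sa; have := f_le a b l; have := ge0 a b; rewrite lP; lia.
- have [_ _ _ _ z] := asp_s_profile beta; have [l lP] := z b.
  have [_ _ _ _ z'] := asp_s_profile alpha; have [A AP] := z' l.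
  by exists A => a /AP sa; have := f_le a b l; have := gec a b; rewrite lP; lia.
Qed.

Lemma demazureP (alpha beta : ASP) :
  demazure_law alpha beta (demazure alpha beta).
Proof.
have [|f fP] := @choice2 (fun a b => is_min_over
    (fun l => (asp_s alpha a l)%:Z + (asp_s beta l b)%:Z)).
  by move=> a b; apply: (@min_over_exists _ 0) => l; lia.
have [delta [sE _]] := asp_of_profile (demazure_profile fP).
have deltaP : demazure_law alpha beta delta by move=> a b; rewrite sE.
by rewrite (demazure_uniq deltaP).
Qed.

(** The count changes by at most one per step, so a single zero at [l0]
    controls all of row [a]. *)
Lemma asp_s_le_after_zero (alpha : ASP) (a l0 l : int) :
  asp_s alpha a l0 = 0%N -> (asp_s alpha a l)%:Z <= Order.max 0 (l0 - l).
Proof.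
move=> z; have [l0l|/ltW ll0] := leP l0 l.
  by have := asp_s_decr alpha a l0l; lia.
by have := asp_s_decr alpha a ll0; lia.
Qed.

(** By duality ([dual] below) the function to maximize can be written with
    counts of either [alpha] or its inverse.  Cuts far to the right and
    far to the left show that [f] is at least 0 and at least c + a - b.
    That these bounds are attained at infinity follows because a count
    with a zero at [l0] lies below a ramp starting at [l0], and the
    subtracted count lies above such a ramp by [asp_s_ge]. *)
Lemma lresidual_profile (alpha beta : ASP) (f : int -> int -> int) :
  (forall a b, is_max_over
     (fun l => (asp_s alpha a l)%:Z - (asp_s (beta^-1)%g b l)%:Z) (f a b)) ->
  asp_profile (shift alpha + shift beta) f.
Proof.
move=> fP; set c := shift alpha + shift beta.
have attained a b : exists l,
    (asp_s alpha a l)%:Z - (asp_s (beta^-1)%g b l)%:Z = f a b.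
  by have [] := max_over_attained (fP a b).
have f_ge a b l : (asp_s alpha a l)%:Z - (asp_s (beta^-1)%g b l)%:Z <= f a b.
  by have [_] := max_over_attained (fP a b).
have dual a b l : (asp_s alpha a l)%:Z - (asp_s (beta^-1)%g b l)%:Z
    = c + a - b + (asp_s (alpha^-1)%g l a)%:Z - (asp_s beta l b)%:Z.
  by have := asp_s_dual alpha a l; have := asp_s_dual beta l b; rewrite /c; lia.
have ge0 a b : 0 <= f a b.
  have [l lP] := asp_s_zeror (beta^-1)%g b.
  by have := f_ge a b l; rewrite lP //; lia.
have gec a b : c + a - b <= f a b.
  have [l lP] := asp_s_zerol beta b.
  by have := f_ge a b l; rewrite dual lP //; lia.
split=> [a b|a|a|b|b].
- have [l lP] := attained a b; have [m mP] := attained (a + 1) (b + 1).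
  have [lm|/ltW ml] := leP l m.
    have := @asp_s_supermod alpha a (a + 1) l m; have := f_ge (a + 1) b l.
    by have := f_ge a (b + 1) m; lia.
  have := @asp_s_supermod (beta^-1)%g b (b + 1) m l; have := f_ge (a + 1) b m.
  by have := f_ge a (b + 1) l; lia.
- have [l0 z] := asp_s_zeror alpha a.
  exists (l0 - shift (beta^-1)%g) => b bl0; have [l lP] := attained a b.
  have := asp_s_le_after_zero l (z l0 (lexx _)).
  by have := asp_s_ge (beta^-1)%g b l; have := ge0 a b; lia.
- have [l0 z] := asp_s_zerol (alpha^-1)%g a.
  exists (shift beta + l0) => b bl0; have [l lP] := attained a b.
  have := asp_s_ge beta l b; have := gec a b.
  have [/z|/ltW l0l] := leP l l0; first by have := dual a b l; lia.
  have := asp_s_incr (alpha^-1)%g a l0l; rewrite z //.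
  by have := dual a b l; lia.
- have [A z] := asp_s_zerol alpha (shift (beta^-1)%g + b).
  exists A => a /z za; have [l lP] := attained a b.
  have := asp_s_le_after_zero l za.
  by have := asp_s_ge (beta^-1)%g b l; have := ge0 a b; lia.
- have [A z] := asp_s_zeror (alpha^-1)%g (b - shift beta).
  exists A => a /z za; have [l lP] := attained a b.
  have := asp_s_ge beta l b; have := gec a b.
  have [l0l|/ltW ll0] := leP (b - shift beta) l.
    by have := asp_s_incr (alpha^-1)%g a l0l; have := dual a b l; lia.
  by have := asp_s_incr (alpha^-1)%g a ll0; have := dual a b l; lia.
Qed.

Lemma lresidualP (alpha beta : ASP) :
  lresidual_law alpha beta (lresidual alpha beta) /\
  shift (lresidual alpha beta) = shift alpha + shift beta.
Proof.
have [|f fP] := @choice2 (fun a b => is_max_over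
    (fun l => (asp_s alpha a l)%:Z - (asp_s (beta^-1)%g b l)%:Z)).
  move=> a b; have [l0 z] := asp_s_zeror alpha a.
  apply: (@max_over_exists _ (Order.max 0 (l0 - shift (beta^-1)%g - b))) => l.
  have := asp_s_le_after_zero l (z l0 (lexx _)).
  by have := asp_s_ge (beta^-1)%g b l; lia.
have [delta [sE deltaS]] := asp_of_profile (lresidual_profile fP).
have deltaP : lresidual_law alpha beta delta by move=> a b; rewrite sE.
by rewrite (lresidual_uniq deltaP).
Qed.

(** * Left residuals in the weak order *)

(** The residual, written s_eta, steps up between rows [v] and [v + 1] at
    column [b] but not between [u] and [u + 1].  So an optimal cut [l] for
    row [v + 1] is at most gamma^-1 v, and every optimal cut [m] for row
    [u] exceeds gamma^-1 u.  If gamma^-1 v < gamma^-1 u, then l < m and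
    supermodularity of s_gamma on the rows v + 1 <= u makes [l] at least
    as good as [m] for row [u]; but then [l] <= gamma^-1 u would be an
    optimal cut there. *)
Lemma lresidual_inversion (gamma delta : ASP) (u v : int) :
  let eta := lresidual gamma delta in
  v < u -> (eta^-1)%g u < (eta^-1)%g v -> (gamma^-1)%g u < (gamma^-1)%g v.
Proof.
move=> eta vu inv; have [law _] := lresidualP gamma delta.
rewrite ltNge; apply/negP => ninv.
have neq : (gamma^-1)%g u != (gamma^-1)%g v.
  by rewrite (can_eq (aspVK gamma)); lia.
set b := (eta^-1)%g v.
have := asp_s_stepl eta v b; have := asp_s_stepl eta u b.
have [[l lP] _] := max_over_attained (law (v + 1) b).
have [[m mP] _] := max_over_attained (law u b).
have [_ /(_ l) vl] := max_over_attained (law v b).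
have [_ /(_ m) vm] := max_over_attained (law (v + 1) b).
have [_ um] := max_over_attained (law (u + 1) b).
have := um l; have := um m.
have := asp_s_stepl gamma v l; have := asp_s_stepl gamma u m.
have := asp_s_stepl gamma u l.
have := @asp_s_supermod gamma (v + 1) u l m.
by rewrite -/eta in lP mP vl vm um *; rewrite -/b in inv *; lia.
Qed.

(** * Reduced products *)

(** For finite permutations this says that the length of [alpha * beta] is
    the sum of the lengths of [alpha] and [beta]. *)
Definition no_common_inversion (alpha beta : ASP) : Prop :=
  forall x y : int,
    x < y -> alpha y < alpha x -> ~ (beta^-1)%g y < (beta^-1)%g x.

(** The hypotheses of [asp_sM_eq] ask the cut to lie above the x with
    beta^-1 x < b and alpha x < a, and weakly below the y with beta^-1 y
    >= b and alpha y >= a.  A pair y < x of such integers would be a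
    common inversion. *)
Lemma no_common_inversion_min (alpha beta : ASP) (a b : int) :
  no_common_inversion alpha beta ->
  exists l, asp_s (alpha * beta)%g a b = (asp_s alpha a l + asp_s beta l b)%N.
Proof.
move=> red; have [u /(_ u (lexx _))/asp_s_eq0 uP] := asp_s_zeror alpha a.
have [v /(_ v (lexx _))/asp_s_eq0 vP] := asp_s_zerol beta b.
have [x y [xb xa] [yb ya]|x [_ xa]|y [yb _]|l [lA lB]] := @int_separation
  [set x | (beta^-1)%g x < b /\ alpha x < a]
  [set y | b <= (beta^-1)%g y /\ a <= alpha y] u v.
- rewrite ltNge le_eqVlt; apply/negP => /orP[/eqP yx|yx].
    by move: yb; rewrite yx; lia.
  by apply: (red _ _ yx); lia.
- by rewrite ltNge; apply/negP => /uP; lia.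
- by rewrite -(aspVK beta y); exact: vP.
exists l; apply: asp_sM_eq => n nb nl.
  rewrite ltNge; apply/negP => na.
  suff : l <= beta n by lia.
  by apply: lB; split; rewrite ?aspK.
rewrite leNgt; apply/negP => na.
suff : beta n < l by lia.
by apply: lA; split; rewrite ?aspK.
Qed.

(** Here the cut is among the values of [alpha], between the images of the
    x < a with beta^-1 x >= b and those of the y >= a with beta^-1 y < b. *)
Lemma no_common_inversion_max (alpha beta : ASP) (a b : int) :
  no_common_inversion alpha beta ->
  exists l, asp_s (alpha * beta)%g l b = (asp_s alpha l a + asp_s beta a b)%N.
Proof.
move=> red; have [u /(_ u (lexx _))/asp_s_eq0 uP] := asp_s_zeror (alpha^-1)%g a.
have [v /(_ v (lexx _))/asp_s_eq0 vP] := asp_s_zerol alpha a.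
have [_ _ [x [xb xa] <-] [y [yb ya] <-]|_ [x [_ xa] <-]|_ [y [_ ya] <-]
  |l [lA lB]] := @int_separation
  (alpha @` [set x | b <= (beta^-1)%g x /\ x < a])
  (alpha @` [set y | (beta^-1)%g y < b /\ a <= y]) u v.
- rewrite ltNge le_eqVlt; apply/negP => /orP[/eqP/(can_inj (aspK alpha)) yx|yx].
    by move: ya; rewrite yx; lia.
  by apply: (@red x y _ yx); lia.
- by rewrite ltNge; apply/negP => /uP; rewrite aspK; lia.
- exact: vP.
exists l; apply: asp_sM_eq => n nb na.
  by apply: lA; exists (beta n); rewrite // /mkset aspK.
by apply: lB; exists (beta n); rewrite // /mkset aspK.
Qed.

Lemma no_common_inversion_demazure (alpha beta : ASP) :
  no_common_inversion alpha beta -> demazure alpha beta = (alpha * beta)%g.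
Proof.
move=> red; apply: demazure_uniq => a b; split.
  have [l E] := no_common_inversion_min a b red.
  by exists l => //; rewrite E PoszD.
by move=> _ [l _ <-]; have := asp_sM_le alpha beta a l b; lia.
Qed.

Lemma no_common_inversion_rresidual (alpha beta : ASP) :
  no_common_inversion alpha beta ->
  rresidual (alpha^-1)%g (alpha * beta)%g = beta.
Proof.
move=> red; apply: rresidual_uniq => a b; rewrite invgK; split.
  have [l E] := no_common_inversion_max a b red.
  by exists l => //; rewrite E; lia.
by move=> _ [l _ <-]; have := asp_sM_le alpha beta l a b; lia.
Qed.

(** A common inversion would be a pair of values inverted by [eta] but not
    by [gamma]. *)
Lemma lresidual_no_common_inversion (gamma delta : ASP) :
  let eta := lresidual gamma delta in
  no_common_inversion eta (eta^-1 * gamma)%g.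
Proof.
move=> eta x y xy inv.
have E z : ((eta^-1 * gamma)^-1)%g z = (gamma^-1)%g (eta z).
  by rewrite invgM invgK.
rewrite !E; have := @lresidual_inversion gamma delta (eta x) (eta y) inv.
rewrite !aspK => /(_ xy); lia.
Qed.

(** * Factorization below a Demazure product *)

Lemma demazure_mono (alpha1 beta1 alpha beta : ASP) :
  bruhat_le alpha1 alpha -> bruhat_le beta1 beta ->
  bruhat_le (demazure alpha1 beta1) (demazure alpha beta).
Proof.
move=> lea leb a b.
have [[l E] _] := min_over_attained (demazureP alpha beta a b).
have [_ /(_ l)] := min_over_attained (demazureP alpha1 beta1 a b).
have := lea a l; have := leb l b; lia.
Qed.

Lemma lresidual_le (alpha beta gamma : ASP) :
  bruhat_le gamma (demazure alpha beta) ->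
  bruhat_le (lresidual gamma (beta^-1)%g) alpha.
Proof.
move=> le a b.
have [[l E] _] := max_over_attained ((lresidualP gamma (beta^-1)%g).1 a b).
have [_ /(_ b)] := min_over_attained (demazureP alpha beta a l).
by have := le a l; rewrite invgK in E; lia.
Qed.

Lemma lresidual_factorization (alpha beta gamma : ASP) :
  shift alpha + shift beta = shift gamma ->
  bruhat_le gamma (demazure alpha beta) ->
  let alpha1 := lresidual gamma (beta^-1)%g in
  let beta1 := rresidual (alpha1^-1)%g gamma in
  [/\ demazure alpha1 beta1 = (alpha1 * beta1)%g,
      (alpha1 * beta1)%g = gamma,
      bruhat_chi_le alpha1 alpha &
      bruhat_chi_le beta1 beta].
Proof.
move=> chi le alpha1 beta1.
have red := @lresidual_no_common_inversion gamma (beta^-1)%g.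
rewrite -/alpha1 in red.
have beta1E : beta1 = (alpha1^-1 * gamma)%g.
  by rewrite -[RHS](no_common_inversion_rresidual red) mulVKg.
rewrite beta1E (no_common_inversion_demazure red) mulVKg.
have [law] := lresidualP gamma (beta^-1)%g.
rewrite shiftV -/alpha1 => alpha1S; split=> //; split.
- exact: lresidual_le.
- lia.
- move=> a b; have [l] := no_common_inversion_max a b red.
  have [_ /(_ b)] := max_over_attained (law l a).
  by rewrite invgK mulVKg -/alpha1; lia.
- by rewrite shiftM shiftV; lia.
Qed.

Theorem theoremC :
  (forall G : {pred ASP},
     group_closed G ->
     {in G &, forall alpha beta : ASP, lresidual alpha beta \in G} ->
     forall alpha beta gamma : ASP,
       alpha \in G -> beta \in G -> gamma \in G ->
       shift alpha + shift beta = shift gamma ->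
       (bruhat_le gamma (demazure alpha beta) <->
        exists alpha1 beta1 : ASP,
          [/\ alpha1 \in G, beta1 \in G,
              bruhat_chi_le alpha1 alpha, bruhat_chi_le beta1 beta &
              demazure alpha1 beta1 = (alpha1 * beta1)%g /\
              (alpha1 * beta1)%g = gamma]))
  /\
  (forall alpha beta gamma : ASP,
     shift alpha + shift beta = shift gamma ->
     bruhat_le gamma (demazure alpha beta) ->
     let alpha1 := lresidual gamma (beta^-1)%g in
     let beta1 := rresidual (alpha1^-1)%g gamma in
     [/\ demazure alpha1 beta1 = (alpha1 * beta1)%g,
         (alpha1 * beta1)%g = gamma,
         bruhat_chi_le alpha1 alpha &
         bruhat_chi_le beta1 beta]).
Proof.
split; last exact: lresidual_factorization.
move=> G [G1 Gdiv] Gres alpha beta gamma Ga Gb Gc chi; split=> [le|].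
  have GV x : x \in G -> (x^-1)%g \in G by move=> Gx; rewrite -div1g Gdiv.
  have [dem prod lea leb] := lresidual_factorization chi le.
  set alpha1 := lresidual _ _ in dem prod lea leb.
  set beta1 := rresidual _ _ in dem prod leb.
  have Ga1 : alpha1 \in G by rewrite Gres ?GV.
  exists alpha1, beta1; split=> //.
  have -> : beta1 = (alpha1^-1 / gamma^-1)%g by rewrite -prod invgK mulKg.
  by rewrite Gdiv ?GV.
case=> alpha1 [beta1 [_ _ [lea _] [leb _] [dem prod]]].
by rewrite -prod -dem; exact: demazure_mono.
Qed.
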